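(* Let $E=\{(-2,0)\}$, $\mu=\delta_{(-2,0)}$, $u\equiv1$, and $g_0=g_{\mathrm E}$. Then $g_\mu=x^2g_{\mathrm E}$. For any two tangential points $z,z'$ in a fixed compact ball contained in $B$, the sequences (defined for $n$ large) $$P_n=(n^{-1},n^{-1},z),\qquad Q_n=(n^{-1},n^{-1},z')$$ are $d_\mu$-Cauchy and satisfy $d_\mu(P_n,Q_n)\to0$. Hence distinct Euclidean corner points represent the same point of the metric completion of $(U_B,d_\mu)$, and the property that all sequences representing a given completion point have one and the same Euclidean limit fails.
   Context: Let $k\ge1$, let $V\subset\mathbb R^k$ be open, $0<\varepsilon<1$, let $B$ be a Euclidean ball relatively compact in $V$, and let $U_B=(0,\varepsilon)^2\times B$ with coordinates $(x,y,z)$ and Euclidean metric $g_{\mathrm E}$. For a finite positive measure $\mu$ with compact support $E\subset\mathbb R^2$ and a positive coefficient $u$, put $F_\mu(x,y,z)=\int_E u(\alpha;x,y,z)x^{-\alpha_1}y^{-\alpha_2}\,d\mu(\alpha)$, $g_\mu=F_\mu g_0$, and let $d_\mu$ be the infimum of $g_\mu$-lengths of absolutely continuous curves in $U_B$. Euclidean corner points are the points $(0,0,z)$ with $z\in B$. *)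

(* Defs.v *)
From HB Require Import structures.
From mathcomp Require Import all_boot all_order all_algebra.
From mathcomp Require Import all_classical all_reals all_analysis.
Set Implicit Arguments.
Unset Strict Implicit.
Unset Printing Implicit Defensive.
Import Order.TTheory GRing.Theory Num.Theory.
Import numFieldNormedType.Exports.
Local Open Scope classical_set_scope.
Local Open Scope ring_scope.

(* The library norm on 'rV[R]_k and on products is the sup norm, so the
   Euclidean inner product and norm are introduced explicitly; the topologies
   agree. *)
Definition row_dot (R : realType) (k : nat) (v w : 'rV[R]_k) : R :=
  \sum_(i < k) v ord0 i * w ord0 i.

Definition open_eball (R : realType) (k : nat) (c : 'rV[R]_k) (r : R) :
    set 'rV[R]_k :=
  [set z | Num.sqrt (row_dot (z - c) (z - c)) < r].

Definition closed_eball (R : realType) (k : nat) (c : 'rV[R]_k) (r : R) :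
    set 'rV[R]_k :=
  [set z | Num.sqrt (row_dot (z - c) (z - c)) <= r].

Definition relatively_compact_in (T : topologicalType) (B V : set T) : Prop :=
  compact (closure B) /\ closure B `<=` V.

(* Points (x, y, z) of R^(2 + k), and also tangent vectors. *)
Notation xyz R k := (R * R * 'rV[R]_k)%type.

Definition UB (R : realType) (k : nat) (eps : R) (B : set 'rV[R]_k) :
    set (xyz R k) :=
  [set p | [/\ 0 < p.1.1 < eps, 0 < p.1.2 < eps & B p.2]].

(* A metric tensor: g p v w is the inner product of the tangent vectors v and w
   at the point p. *)
Definition tensor (R : realType) (k : nat) :=
  xyz R k -> xyz R k -> xyz R k -> R.

Definition gE (R : realType) (k : nat) : tensor R k :=
  fun _ v w => v.1.1 * w.1.1 + v.1.2 * w.1.2 + row_dot v.2 w.2.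

Definition enorm (R : realType) (k : nat) (v : xyz R k) : R :=
  Num.sqrt (gE 0 v v).

Definition Fmu (R : realType) (k : nat) (E : set (R * R)%type)
    (mu : {finite_measure set (R * R)%type -> \bar R})
    (u : R * R -> xyz R k -> R) (p : xyz R k) : R :=
  \int[mu]_(a in E) (u a p * p.1.1 `^ (- a.1) * p.1.2 `^ (- a.2)).

Definition gmu (R : realType) (k : nat) (E : set (R * R)%type)
    (mu : {finite_measure set (R * R)%type -> \bar R})
    (u : R * R -> xyz R k -> R) (g0 : tensor R k) : tensor R k :=
  fun p v w => Fmu E mu u p * g0 p v w.

Definition absolutely_continuous01 (R : realType) (k : nat)
    (gamma : R -> xyz R k) : Prop :=
  forall e : R, 0 < e -> exists2 delta : R, 0 < delta &
    forall (n : nat) (a b : nat -> R),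
      (forall i, (i < n)%N -> 0 <= a i /\ a i <= b i /\ b i <= 1) ->
      trivIset `I_n (fun i => `]a i, b i[%classic) ->
      \sum_(i < n) (b i - a i) < delta ->
      \sum_(i < n) enorm (gamma (b i) - gamma (a i)) < e.

Definition velocity (R : realType) (k : nat) (gamma : R -> xyz R k) (t : R) :
    xyz R k :=
  (derive1 (fun s => (gamma s).1.1) t, derive1 (fun s => (gamma s).1.2) t,
   \row_i derive1 (fun s => (gamma s).2 ord0 i) t).

(* An absolutely continuous curve is differentiable almost everywhere on
   [0, 1], so the value of the velocity elsewhere is irrelevant. *)
Definition curve_length (R : realType) (k : nat) (g : tensor R k)
    (gamma : R -> xyz R k) : \bar R :=
  (\int[lebesgue_measure]_(t in `[0%R, 1%R])
     (Num.sqrt (g (gamma t) (velocity gamma t) (velocity gamma t)))%:E)%E.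

Definition curve_between (R : realType) (k : nat) (U : set (xyz R k))
    (p q : xyz R k) (gamma : R -> xyz R k) : Prop :=
  [/\ absolutely_continuous01 gamma, gamma 0 = p, gamma 1 = q &
      forall t : R, 0 <= t <= 1 -> U (gamma t)].

Definition length_dist (R : realType) (k : nat) (U : set (xyz R k))
    (g : tensor R k) (p q : xyz R k) : \bar R :=
  ereal_inf (curve_length g @` [set gamma | curve_between U p q gamma]).

Definition cauchy_in (R : realType) (T : Type) (U : set T)
    (d : T -> T -> \bar R) (s : nat -> T) : Prop :=
  (forall n, U (s n)) /\
  forall e : R, 0 < e -> exists N : nat, forall m n : nat,
    (N <= m)%N -> (N <= n)%N -> (d (s m) (s n) < e%:E)%E.

(* The points of the metric completion of (U, d) are the classes of Cauchy
   sequences of U modulo d (s n) (t n) --> 0; a sequence represents a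
   completion point when it belongs to it. *)
Definition completion_class (R : realType) (T : Type) (U : set T)
    (d : T -> T -> \bar R) (s : nat -> T) : set (nat -> T) :=
  [set t | cauchy_in U d t /\ d (s n) (t n) @[n --> \oo] --> 0%E].

Definition completion (R : realType) (T : Type) (U : set T)
    (d : T -> T -> \bar R) : set (set (nat -> T)) :=
  completion_class U d @` [set s | cauchy_in U d s].

Definition one_euclidean_limit (R : realType) (k : nat)
    (X : set (nat -> xyz R k)) : Prop :=
  exists a : xyz R k, forall s, X s -> s n @[n --> \oo] --> a.

Definition corner_pt (R : realType) (k : nat) (z : 'rV[R]_k) : xyz R k :=
  (0, 0, z).

(* The sequence (1/n, 1/n, z), for n >= n0. *)
Definition diag_seq (R : realType) (k : nat) (n0 : nat) (z : 'rV[R]_k)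
    (n : nat) : xyz R k :=
  ((n0 + n)%:R^-1, (n0 + n)%:R^-1, z).

(* Main.v *)
(** For [g = x^2 gE] a straight segment from [p] to [q] has [g]-length at most
    [max (x p) (x q)] times the Euclidean distance of [p] and [q], and it stays
    in [UB] because balls are convex. The points [(1/n, 1/n, z)] and
    [(1/m, 1/m, z')] are at bounded Euclidean distance, so their [g]-distance is
    [O(max (1/n, 1/m))]. This single estimate makes the sequences Cauchy and
    equivalent, although their Euclidean limits differ. *)
Require Import Defs.
From HB Require Import structures.
From mathcomp Require Import all_boot all_order all_algebra.
From mathcomp Require Import all_classical all_reals all_analysis.
From mathcomp Require Import measurable_realfun ring lra.
Set Implicit Arguments.
Unset Strict Implicit.
Unset Printing Implicit Defensive.
Import Order.TTheory GRing.Theory Num.Theory.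
Import numFieldNormedType.Exports.
Local Open Scope classical_set_scope.
Local Open Scope ring_scope.

(** * Convexity of Euclidean balls *)

Lemma row_dotZ (R : realType) (k : nat) (a : R) (v : 'rV[R]_k) :
  row_dot (a *: v) (a *: v) = a ^+ 2 * row_dot v v.
Proof.
by rewrite /row_dot mulr_sumr; apply: eq_bigr => i _; rewrite !mxE; ring.
Qed.

(** In each coordinate the two sides differ by [t * (1 - t) * (y - x) ^+ 2]. Working with squares
    replaces the triangle inequality. *)
Lemma row_dot_convex (R : realType) (k : nat) (t : R) (v w : 'rV[R]_k) :
  0 <= t <= 1 ->
  row_dot (v + t *: (w - v)) (v + t *: (w - v)) <=
  (1 - t) * row_dot v v + t * row_dot w w.
Proof.
move=> /andP[t0 t1]; rewrite /row_dot !mulr_sumr -big_split /=.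
apply: ler_sum => i _; rewrite !mxE.
set x := v _ _; set y := w _ _.
rewrite -subr_ge0.
have -> : (1 - t) * (x * x) + t * (y * y)
    - (x + t * (y - x)) * (x + t * (y - x)) = t * (1 - t) * (y - x) ^+ 2.
  by ring.
by rewrite mulr_ge0 ?sqr_ge0 // mulr_ge0 ?subr_ge0.
Qed.

Lemma open_eballE (R : realType) (k : nat) (c : 'rV[R]_k) (r : R)
    (z : 'rV[R]_k) : 0 < r ->
  open_eball c r z <-> row_dot (z - c) (z - c) < r ^+ 2.
Proof.
move=> r0; rewrite /open_eball /=.
by rewrite -[X in _ < X](@ger0_norm _ r) ?ltW // -sqrtr_sqr ltr_sqrt ?exprn_gt0.
Qed.

Lemma open_eball_convex (R : realType) (k : nat) (c : 'rV[R]_k) (r t : R)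
    (z z' : 'rV[R]_k) : 0 < r -> 0 <= t <= 1 ->
  open_eball c r z -> open_eball c r z' -> open_eball c r (z + t *: (z' - z)).
Proof.
move=> r0 t01 /open_eballE-/(_ r0) hz /open_eballE-/(_ r0) hz'.
apply/open_eballE => //.
have -> : z + t *: (z' - z) - c = (z - c) + t *: ((z' - c) - (z - c)).
  by rewrite opprB addrA subrK addrAC.
apply: le_lt_trans (row_dot_convex _ _ t01) _.
move: hz hz' t01; set A := row_dot _ _; set A' := row_dot _ _.
(* A convex combination is at most the larger of its two terms, which the case split selects. *)
by move=> hA hA' /andP[t0 t1]; case: (leP A A') => AA'; nra.
Qed.

(** * Straight segments as admissible curves *)

Definition segment (R : realType) (k : nat) (p q : xyz R k) (t : R) : xyz R k :=
  (p.1.1 + t * (q.1.1 - p.1.1), p.1.2 + t * (q.1.2 - p.1.2),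
   p.2 + t *: (q.2 - p.2)).

Lemma derive1_affine (R : realType) (a b t : R) :
  derive1 (fun s => a + s * b) t = b.
Proof.
rewrite derive1E; apply: derive_val.
have -> : (fun s => a + s * b) = cst a + (fun s : R => s) * cst b by [].
apply: is_derive_eq.
by rewrite add0r scaler0 add0r /GRing.scale /= mulr1.
Qed.

Lemma velocity_segment (R : realType) (k : nat) (p q : xyz R k) (t : R) :
  velocity (segment p q) t = q - p.
Proof.
rewrite /velocity /segment /= !derive1_affine; congr (_, _, _).
apply/rowP => i; rewrite !mxE -[RHS](@derive1_affine _ (p.2 ord0 i) _ t).
by congr derive1; apply/funext => s; rewrite !mxE.
Qed.

Lemma segmentB (R : realType) (k : nat) (p q : xyz R k) (a b : R) :
  segment p q b - segment p q a =
  ((b - a) * (q.1.1 - p.1.1), (b - a) * (q.1.2 - p.1.2),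
   (b - a) *: (q.2 - p.2)).
Proof.
rewrite /segment; congr (_, _, _) => /=; [ring|ring|].
by rewrite opprD addrACA subrr add0r scalerBl.
Qed.

Lemma enorm_segmentB (R : realType) (k : nat) (p q : xyz R k) (a b : R) :
  a <= b ->
  enorm (segment p q b - segment p q a) = (b - a) * enorm (q - p).
Proof.
move=> ab; rewrite /enorm segmentB.
rewrite [X in Num.sqrt X](_ : _ = (b - a) ^+ 2 * gE 0 (q - p) (q - p)).
  by rewrite sqrtrM ?sqr_ge0 // sqrtr_sqr ger0_norm ?subr_ge0.
by rewrite /gE /= row_dotZ; ring.
Qed.

(** The segment is Lipschitz with constant [K], the Euclidean distance of its ends. Dividing by
    [K + 1] also covers [p = q]. *)
Lemma segment_ac (R : realType) (k : nat) (p q : xyz R k) :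
  absolutely_continuous01 (segment p q).
Proof.
move=> e e0; set K := enorm (q - p).
have K0 : 0 <= K by exact: sqrtr_ge0.
have K1 : 0 < K + 1 by rewrite ltr_wpDl.
exists (e / (K + 1)); first exact: divr_gt0.
move=> n a b ab _ hs.
rewrite (eq_bigr (fun i : 'I_n => (b i - a i) * K)); last first.
  by move=> i _; apply: enorm_segmentB; case: (ab i (ltn_ord i)) => _ [].
rewrite -mulr_suml; move: hs; rewrite ltr_pdivlMr // => hs.
apply: le_lt_trans hs; apply: ler_wpM2l; last by rewrite lerDl.
by apply: sumr_ge0 => i _; rewrite subr_ge0; case: (ab i (ltn_ord i)) => _ [].
Qed.

Lemma itv_oo_convex (R : realType) (l u a b t : R) : 0 <= t <= 1 ->
  l < a < u -> l < b < u -> l < a + t * (b - a) < u.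
Proof.
move=> /andP[t0 t1] /andP[la au] /andP[lb bu].
by apply/andP; split; case: (leP a b) => ab; nra.
Qed.

Lemma segment_UB (R : realType) (k : nat) (eps : R) (c : 'rV[R]_k) (r t : R)
    (p q : xyz R k) : 0 < r -> 0 <= t <= 1 ->
  UB eps (open_eball c r) p -> UB eps (open_eball c r) q ->
  UB eps (open_eball c r) (segment p q t).
Proof.
move=> r0 t01 [p1 p2 pB] [q1 q2 qB].
by split; [exact: itv_oo_convex|exact: itv_oo_convex|exact: open_eball_convex].
Qed.

(** * Bounds on the length distance *)

Lemma length_dist_ge0 (R : realType) (k : nat) (U : set (xyz R k))
    (g : tensor R k) (p q : xyz R k) : (0 <= length_dist U g p q)%E.
Proof.
apply/ereal_infP => _ [gamma _ <-].
by apply: integral_ge0 => t _; rewrite lee_fin sqrtr_ge0.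
Qed.

(** The segment competes in the infimum. Its speed is its [x] coordinate times the constant
    [enorm (q - p)], and [x] is affine in [t], hence at most [M]. *)
Lemma length_dist_le_segment (R : realType) (k : nat) (eps : R)
    (c : 'rV[R]_k) (r : R) (g : tensor R k) (M : R) (p q : xyz R k) :
  let U := UB eps (open_eball c r) in
  0 < r ->
  (forall p v w, U p -> g p v w = p.1.1 ^+ 2 * gE p v w) ->
  U p -> U q -> p.1.1 <= M -> q.1.1 <= M ->
  (length_dist U g p q <= (M * enorm (q - p))%:E)%E.
Proof.
move=> U r0 gU Up Uq pM qM.
have Us (t : R) : 0 <= t <= 1 -> U (segment p q t).
  by move=> ?; exact: segment_UB.
apply: (@le_trans _ _ (curve_length g (segment p q))).
  apply: ereal_inf_lbound; exists (segment p q) => //; split => //.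
  - exact: segment_ac.
  - by rewrite /segment !mul0r scale0r !addr0; case: (p) => -[].
  - rewrite /segment !mul1r scale1r !(addrC _ (_ - _)) !subrK.
    by case: (q) => -[].
have E0 : 0 <= enorm (q - p) by exact: sqrtr_ge0.
rewrite /curve_length.
(* Since [x] is positive on [U], the root of [x ^+ 2] is [x] itself. *)
have spd (t : R) : `[0%R, 1%R]%classic t ->
    (Num.sqrt (g (segment p q t) (velocity (segment p q) t)
       (velocity (segment p q) t)))%:E
    = ((p.1.1 + t * (q.1.1 - p.1.1)) * enorm (q - p))%:E.
  rewrite /= in_itv /= => /Us Ut; rewrite gU // velocity_segment.
  rewrite sqrtrM ?sqr_ge0 // sqrtr_sqr ger0_norm //.
  by case: Ut => /andP[/ltW].
have -> : (\int[lebesgue_measure]_(t in `[0%R, 1%R]) (Num.sqrt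
    (g (segment p q t) (velocity (segment p q) t)
       (velocity (segment p q) t)))%:E
    = \int[lebesgue_measure]_(t in `[0%R, 1%R])
    ((p.1.1 + t * (q.1.1 - p.1.1)) * enorm (q - p))%:E)%E.
  by apply: eq_integral => t; rewrite inE => /spd.
apply: (@le_trans _ _ (\int[lebesgue_measure]_(t in `[0%R, 1%R])
   (cst (M * enorm (q - p))%:E t))%E).
  apply: ge0_le_integral => //.
  (* Nonnegativity is read off the square root form of the speed. *)
  - by move=> t t01; rewrite -spd // lee_fin sqrtr_ge0.
  - apply/measurable_EFinP; apply: measurable_funTS.
    apply: continuous_measurable_fun => t.
    apply: cvgM; last exact: cvg_cst.
    apply: cvgD; first exact: cvg_cst.
    by apply: cvgM; [exact: cvg_id | exact: cvg_cst].
  - move=> t; rewrite /= in_itv /= => /andP[t0 t1].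
    by rewrite lee_fin; apply: ler_wpM2r => //; nra.
by rewrite integral_cst //= lebesgue_measure_itv /= lte_fin ltr01 sube0 mule1.
Qed.

(** * Diagonal sequences *)

(** The first two coordinates lie in the interval from 0 to 1, so each contributes at most 1 to the
    squared distance; hence the 2. *)
Lemma enorm_diag_le (R : realType) (k : nat) (n0 m n : nat) (z z' : 'rV[R]_k) :
  enorm (diag_seq n0.+1 z' n - diag_seq n0.+1 z m) <=
  Num.sqrt (2 + row_dot (z' - z) (z' - z)).
Proof.
rewrite /enorm ler_wsqrtr // /gE /= lerD2r.
have h (i : nat) : 0 < ((n0.+1 + i)%:R^-1 : R) <= 1.
  by rewrite addSn invr_gt0 ltr0Sn /= invf_le1 ?ltr0Sn // ler1n.
move: (h n) (h m) => /andP[] + + /andP[].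
set x := _^-1; set y := _^-1 => x0 x1 y0 y1.
have : (x - y) * (x - y) <= 1 by nra.
lra.
Qed.

Lemma diag_seq_UB (R : realType) (k : nat) (eps : R) (B : set 'rV[R]_k)
    (n0 n : nat) (z : 'rV[R]_k) :
  (0 < n0)%N -> n0%:R^-1 < eps -> B z -> UB eps B (diag_seq n0 z n).
Proof.
case: n0 => // n0 _ ne Bz.
have h : 0 < ((n0.+1 + n)%:R^-1 : R) < eps.
  rewrite addSn invr_gt0 ltr0Sn /=; apply: le_lt_trans ne.
  by rewrite lef_pV2 ?posrE ?ltr0Sn // ler_nat ltnS leq_addr.
by split.
Qed.

(** The indices and the tangential points vary independently: [z = z'] yields the Cauchy property,
    [m = n] the equivalence of the two sequences. The bound has [N.+1] because [n0] is at least
    1. *)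
Lemma diag_seq_dist_le (R : realType) (k : nat) (eps : R) (c : 'rV[R]_k)
    (r : R) (g : tensor R k) (n0 N m n : nat) (z z' : 'rV[R]_k) :
  let U := UB eps (open_eball c r) in
  0 < r ->
  (forall p v w, U p -> g p v w = p.1.1 ^+ 2 * gE p v w) ->
  open_eball c r z -> open_eball c r z' -> (0 < n0)%N -> n0%:R^-1 < eps ->
  (N <= m)%N -> (N <= n)%N ->
  (length_dist U g (diag_seq n0 z m) (diag_seq n0 z' n) <=
   (N.+1%:R^-1 * Num.sqrt (2 + row_dot (z' - z) (z' - z)))%:E)%E.
Proof.
move=> U r0 gU Bz Bz' n00 ne Nm Nn.
have h i : (N <= i)%N -> (n0 + i)%:R^-1 <= (N.+1%:R^-1 : R).
  move=> Ni; rewrite lef_pV2 ?posrE ?ltr0n ?addn_gt0 ?n00 // ler_nat.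
  by rewrite -add1n leq_add.
apply: le_trans (length_dist_le_segment (M := N.+1%:R^-1) r0 gU _ _ _ _) _.
- exact: diag_seq_UB.
- exact: diag_seq_UB.
- exact: h.
- exact: h.
rewrite lee_fin ler_wpM2l ?invr_ge0 //.
by case: n0 n00 {ne h} => // n0 _; exact: enorm_diag_le.
Qed.

Lemma harmonicZ_lt (R : realType) (D e : R) : 0 <= D -> 0 < e ->
  exists N : nat, N.+1%:R^-1 * D < e.
Proof.
(* The truncation of [D / e] plus one exceeds [D / e]. *)
move=> D0 e0; exists (Num.truncn (D / e)).
rewrite mulrC ltr_pdivrMr ?ltr0Sn // mulrC -ltr_pdivrMr //.
exact: truncnS_gt.
Qed.

Lemma diag_seq_cauchy (R : realType) (k : nat) (eps : R) (c : 'rV[R]_k)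
    (r : R) (g : tensor R k) (n0 : nat) (z : 'rV[R]_k) :
  let U := UB eps (open_eball c r) in
  0 < r ->
  (forall p v w, U p -> g p v w = p.1.1 ^+ 2 * gE p v w) ->
  open_eball c r z -> (0 < n0)%N -> n0%:R^-1 < eps ->
  cauchy_in U (length_dist U g) (diag_seq n0 z).
Proof.
move=> U r0 gU Bz n00 ne; split=> [n|e e0]; first exact: diag_seq_UB.
have [N hN] := harmonicZ_lt
  (sqrtr_ge0 (2 + row_dot (z - z) (z - z))) e0.
exists N => m n Nm Nn.
apply: le_lt_trans (diag_seq_dist_le r0 gU Bz Bz n00 ne Nm Nn) _.
by rewrite lte_fin.
Qed.

Lemma diag_seq_dist_cvg0 (R : realType) (k : nat) (eps : R) (c : 'rV[R]_k)
    (r : R) (g : tensor R k) (n0 : nat) (z z' : 'rV[R]_k) :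
  let U := UB eps (open_eball c r) in
  0 < r ->
  (forall p v w, U p -> g p v w = p.1.1 ^+ 2 * gE p v w) ->
  open_eball c r z -> open_eball c r z' -> (0 < n0)%N -> n0%:R^-1 < eps ->
  length_dist U g (diag_seq n0 z n) (diag_seq n0 z' n) @[n --> \oo] --> 0%E.
Proof.
move=> U r0 gU Bz Bz' n00 ne.
set D := Num.sqrt (2 + row_dot (z' - z) (z' - z)).
apply: (@squeeze_cvge _ _ _ _ (cst 0%E) _ (fun n => (n.+1%:R^-1 * D)%:E)).
- near=> n; rewrite length_dist_ge0 /=.
  (* The estimate is used with [N = m = n]. *)
  exact: diag_seq_dist_le.
- exact: cvg_cst.
- apply: cvg_EFin; first by near=> n.
  rewrite -(mul0r D); apply: cvgM; last exact: cvg_cst.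
  exact: cvg_harmonic.
Unshelve. all: by end_near. Qed.

Lemma diag_seq_cvg (R : realType) (k : nat) (n0 : nat) (z : 'rV[R]_k) :
  diag_seq n0 z n @[n --> \oo] --> corner_pt z.
Proof.
have h : (n0 + n)%:R^-1 @[n --> \oo] --> (0 : R).
  (* After a shift by one the terms are bounded by [1 / (n + 1)] for every [n0]; for [n0 = 0] this
     skips the inverse of 0. *)
  rewrite -(cvg_shiftn 1) /=.
  apply: (@squeeze_cvgr _ _ _ _ (cst (0 : R)) (@harmonic R)).
  - near=> n; rewrite invr_ge0 ler0n /= addn1 addnS.
    by rewrite lef_pV2 ?posrE ?ltr0Sn // ler_nat ltnS leq_addl.
  - exact: (@cvg_cst R).
  - exact: cvg_harmonic.
exact: (cvg_pair (cvg_pair h h) (@cvg_cst _ z _ _ _)).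
Unshelve. all: by end_near. Qed.

(** * The Dirac weight and the failure of a unique Euclidean limit *)

(** On the singleton the integrand is constant, equal to its value at [a], and the Dirac mass of the
    singleton is 1. *)
Lemma Fmu_dirac (R : realType) (k : nat) (a : R * R)
    (u : R * R -> xyz R k -> R) (p : xyz R k) :
  Fmu [set a] (\d_a : {finite_measure set (R * R)%type -> \bar R}) u p =
  u a p * p.1.1 `^ (- a.1) * p.1.2 `^ (- a.2).
Proof.
have mE : measurable [set a].
  have -> : [set a] = [set a.1] `*` [set a.2].
    by case: a => a1 a2; apply/seteqP; split => [_ ->//|[x y] /= [-> ->]].
  exact: measurableX.
rewrite /Fmu; transitivity (\int[\d_a]_(b in [set a])
    (u a p * p.1.1 `^ (- a.1) * p.1.2 `^ (- a.2)) : R).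
  by apply: eq_Rintegral => b; rewrite inE => ->.
by rewrite Rintegral_cst //= indicE mem_set // mulr1.
Qed.

Theorem proposition10p3 (R : realType) (k : nat) (hk : (1 <= k)%N)
    (V : set 'rV[R]_k) (hV : open V)
    (eps : R) (heps0 : 0 < eps) (heps1 : eps < 1)
    (c : 'rV[R]_k) (r : R) (hr : 0 < r)
    (hB : relatively_compact_in (open_eball c r) V) :
  let B := open_eball c r in
  let U := UB eps B in
  let E : set (R * R)%type := [set (- 2, 0)] in
  let mu : {finite_measure set (R * R)%type -> \bar R} :=
    (\d_((- 2, 0) : R * R))%R in
  let u : R * R -> xyz R k -> R := fun _ _ => 1 in
  let g : tensor R k := gmu E mu u (@gE R k) in
  let d : xyz R k -> xyz R k -> \bar R := length_dist U g in
  [/\ (forall p v w : xyz R k, U p -> g p v w = p.1.1 ^+ 2 * gE p v w),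
      (forall (c' : 'rV[R]_k) (r' : R), closed_eball c' r' `<=` B ->
       forall (z z' : 'rV[R]_k), closed_eball c' r' z -> closed_eball c' r' z' ->
       forall n0 : nat, (0 < n0)%N -> n0%:R^-1 < eps ->
       [/\ cauchy_in U d (diag_seq n0 z), cauchy_in U d (diag_seq n0 z') &
           d (diag_seq n0 z n) (diag_seq n0 z' n) @[n --> \oo] --> 0%E]),
      (forall (z z' : 'rV[R]_k), B z -> B z' -> z <> z' ->
       forall n0 : nat, (0 < n0)%N -> n0%:R^-1 < eps ->
       exists X : set (nat -> xyz R k),
         [/\ completion U d X, X (diag_seq n0 z), X (diag_seq n0 z'),
             diag_seq n0 z n @[n --> \oo] --> corner_pt z &
             diag_seq n0 z' n @[n --> \oo] --> corner_pt z']) &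
      ~ (forall X : set (nat -> xyz R k),
           completion U d X -> one_euclidean_limit X)].
Proof.
move=> B U E mu u g d.
(* The exponents are [- - 2 = 2] and [- 0 = 0]; the real power of [x] becomes a square because [x]
   is nonnegative on [U]. *)
have gU p v w : U p -> g p v w = p.1.1 ^+ 2 * gE p v w.
  case=> /andP[/ltW p0 _] _ _.
  by rewrite /g /gmu Fmu_dirac /u /= mul1r opprK oppr0 powRr0 mulr1 powR_mulrn.
have cau z n0 : B z -> (0 < n0)%N -> n0%:R^-1 < eps ->
    cauchy_in U d (diag_seq n0 z).
  by move=> *; exact: diag_seq_cauchy.
have lim0 z z' n0 : B z -> B z' -> (0 < n0)%N -> n0%:R^-1 < eps ->
    d (diag_seq n0 z n) (diag_seq n0 z' n) @[n --> \oo] --> 0%E.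
  by move=> *; exact: diag_seq_dist_cvg0.
have identified (z z' : 'rV[R]_k) : B z -> B z' -> z <> z' ->
    forall n0 : nat, (0 < n0)%N -> n0%:R^-1 < eps ->
    exists X : set (nat -> xyz R k),
      [/\ completion U d X, X (diag_seq n0 z), X (diag_seq n0 z'),
          diag_seq n0 z n @[n --> \oo] --> corner_pt z &
          diag_seq n0 z' n @[n --> \oo] --> corner_pt z'].
  move=> Bz Bz' _ n0 n00 ne.
  (* The class of the first sequence contains the second one by [lim0]. *)
  exists (completion_class U d (diag_seq n0 z)).
  split; [|by split; auto|by split; auto|exact: diag_seq_cvg..].
  by exists (diag_seq n0 z) => //; exact: cau.
split => //.
  move=> c' r' sub z z' hz hz' n0 n00 ne.
  by split; [apply: cau|apply: cau|apply: lim0] => //; exact: sub.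
move=> one.
pose i0 := Ordinal hk.
(* A second point of the ball, half a radius from the centre along a coordinate axis, which exists
   as [k] is at least 1. *)
pose z' := c + (r / 2) *: delta_mx ord0 i0.
have Bc : B c.
  apply/open_eballE => //.
  by rewrite subrr /row_dot big1 ?exprn_gt0 // => i _; rewrite mxE mul0r.
have Bz' : B z'.
  apply/open_eballE => //; rewrite /z' addrAC subrr add0r row_dotZ.
  rewrite /row_dot (bigD1 i0) //= big1 => [|i /negPf ii0];
    rewrite !mxE ?eqxx ?ii0 /=.
    by nra.
  by rewrite mulr0.
have cz' : c <> z'.
  move=> /(congr1 (fun v : 'rV[R]_k => v ord0 i0)); rewrite /z' !mxE !eqxx /=.
  by lra.
(* Starting the sequences at [N.+1] keeps their first two coordinates below [eps]. *)
have [N hN] := harmonicZ_lt ler01 heps0.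
rewrite mulr1 in hN.
have [X [CX X1 X2 L1 L2]] := identified _ _ Bc Bz' cz' N.+1 isT hN.
(* A common Euclidean limit [a] would equal both corner points, since limits are unique in a normed
   space. *)
have [a la] := one _ CX.
have e1 : a = corner_pt c.
  by apply: (cvg_unique (@norm_hausdorff _ _) (la _ X1) L1).
have e2 : a = corner_pt z'.
  by apply: (cvg_unique (@norm_hausdorff _ _) (la _ X2) L2).
by apply: cz'; have := congr1 snd (etrans (esym e1) e2).
Qed.
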